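(* Let $\mathcal T$ be a locally finite triangulated category and $F:\mathcal T\to\mathcal T$ an autoequivalence such that the orbit category $\mathcal O_F:=\mathcal T/F$ is triangulated and the projection functor $\pi_F:\mathcal T\rightarrow \mathcal O_F$ is a triangle functor. Let $m\ge 1$. Then there is a bijection between the set of $F$-periodic $m$-cluster tilting subcategories of $\mathcal T$ and the set of $m$-cluster tilting subcategories of $\mathcal O_F$.
   Context: A triangulated category $\mathcal T$ (with suspension $\Sigma$) is locally finite if for every indecomposable object $X$ there are only finitely many isomorphism classes of indecomposable objects $Y$ with $\mathrm{Hom}_{\mathcal T}(X,Y)\neq 0$ (the dual condition is then automatic). The orbit category $\mathcal O_F=\mathcal T/F$ has the same objects as $\mathcal T$ and morphisms $\mathrm{Hom}_{\mathcal O_F}(X,Y)=\bigoplus_{p\in\mathbb Z}\mathrm{Hom}_{\mathcal T}(X,F^pY)$; $\pi_F$ is the natural projection. Subcategories are full and closed under isomorphism. In a triangulated category write $\mathrm{Ext}^i(X,Y)=\mathrm{Hom}(X,\Sigma^iY)$. A subcategory $\mathcal X$ of a triangulated category $\mathcal C$ is $m$-cluster tilting if it is functorially finite (i.e. both covariantly and contravariantly finite) and $$\mathcal X=\{Z\in\mathcal C\mid \mathrm{Ext}^i_{\mathcal C}(\mathcal X,Z)=0\text{ for }0<i<m\}=\{Z\in\mathcal C\mid \mathrm{Ext}^i_{\mathcal C}(Z,\mathcal X)=0\text{ for }0<i<m\}.$$ A subcategory $\mathcal X$ of $\mathcal T$ is $F$-periodic if $F\mathcal X=\mathcal X$. *)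

(* Defs.v *)
From HB Require Import structures.
From mathcomp Require Import all_boot all_order all_algebra.
From mathcomp Require Import zify.
From mathcomp Require Import boolp classical_sets functions cardinality fsbigop.

Set Implicit Arguments.
Unset Strict Implicit.
Unset Printing Implicit Defensive.

Import GRing.Theory.
Local Open Scope classical_set_scope.
Local Open Scope ring_scope.

Record preadditive := Preadditive {
  ob :> Type;
  hom : ob -> ob -> zmodType;
  idc : forall X, hom X X;
  comp : forall X Y Z, hom Y Z -> hom X Y -> hom X Z;
  compA : forall X Y Z W (h : hom Z W) (g : hom Y Z) (f : hom X Y),
    comp h (comp g f) = comp (comp h g) f;
  comp1c : forall X Y (f : hom X Y), comp (idc Y) f = f;
  compc1 : forall X Y (f : hom X Y), comp f (idc X) = f;
  compDl : forall X Y Z (g g' : hom Y Z) (f : hom X Y),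
    comp (g + g') f = comp g f + comp g' f;
  compDr : forall X Y Z (g : hom Y Z) (f f' : hom X Y),
    comp g (f + f') = comp g f + comp g f' }.

Arguments hom {_} X Y.
Arguments idc {_} X.
Arguments comp {_ X Y Z} g f.

Declare Scope cat_scope.
Delimit Scope cat_scope with C.
Local Open Scope cat_scope.
Notation "g \oc f" := (comp g f) (at level 40, left associativity) : cat_scope.

Definition is_iso (C : preadditive) (X Y : C) (f : hom X Y) : Prop :=
  exists g : hom Y X, g \oc f = idc X /\ f \oc g = idc Y.

Definition isomorphic (C : preadditive) (X Y : C) : Prop :=
  exists f : hom X Y, is_iso f.

Definition is_zero (C : preadditive) (X : C) : Prop :=
  forall Y : C, (forall f : hom X Y, f = 0) /\ (forall f : hom Y X, f = 0).

Definition is_biproduct (C : preadditive) (A B S : C) : Prop :=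
  exists (i : hom A S) (j : hom B S) (p : hom S A) (q : hom S B),
    [/\ p \oc i = idc A, q \oc j = idc B, p \oc j = 0, q \oc i = 0
      & i \oc p + j \oc q = idc S].

Definition is_additive (C : preadditive) : Prop :=
  (exists X : C, is_zero X) /\ forall A B : C, exists S : C, is_biproduct A B S.

Definition indecomposable (C : preadditive) (X : C) : Prop :=
  ~ is_zero X /\ forall A B : C, is_biproduct A B X -> is_zero A \/ is_zero B.

(* Functors between preadditive categories are required to be additive. *)
Record functor (C D : preadditive) := Functor {
  fob :> C -> D;
  fmap : forall X Y, hom X Y -> hom (fob X) (fob Y);
  fmap1 : forall X, fmap (idc X) = idc (fob X);
  fmap_comp : forall X Y Z (g : hom Y Z) (f : hom X Y),
    fmap (g \oc f) = fmap g \oc fmap f;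
  fmapD : forall X Y (f g : hom X Y), fmap (f + g) = fmap f + fmap g }.

Arguments fmap {C D} f {X Y} _ : rename.

Definition id_functor (C : preadditive) : functor C C.
Proof. by exists (fun X => X) (fun _ _ f => f). Defined.

Definition comp_functor (C D E : preadditive) (G : functor D E) (F : functor C D) :
  functor C E.
Proof.
exists (fun X => G (F X)) (fun X Y f => fmap G (fmap F f)).
- by move=> X; rewrite !fmap1.
- by move=> *; rewrite !fmap_comp.
- by move=> *; rewrite !fmapD.
Defined.

Fixpoint iter_functor (C : preadditive) (n : nat) (F : functor C C) : functor C C :=
  if n is n'.+1 then comp_functor F (iter_functor n' F) else id_functor C.

Record natiso (C D : preadditive) (F G : functor C D) := NatIso {
  nt :> forall X, hom (F X) (G X);
  nt_inv : forall X, hom (G X) (F X);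
  nt_natural : forall X Y (f : hom X Y), nt Y \oc fmap F f = fmap G f \oc nt X;
  nt_invK : forall X, nt_inv X \oc nt X = idc (F X);
  nt_Kinv : forall X, nt X \oc nt_inv X = idc (G X) }.

Arguments nt_inv {C D F G} n X : rename.

(* No triangle identities are required of the unit and the counit. *)
Record autoequivalence (C : preadditive) := AutoEquivalence {
  aeq :> functor C C;
  aeq_inv : functor C C;
  aeq_unit : natiso (id_functor C) (comp_functor aeq_inv aeq);
  aeq_counit : natiso (comp_functor aeq aeq_inv) (id_functor C) }.

Arguments aeq_inv {C} a.
Arguments aeq_unit {C} a.
Arguments aeq_counit {C} a.

(* [dist f g h] says that X -f-> Y -g-> Z -h-> Sigma X is distinguished. *)
Record triangulation (C : preadditive) := Triangulation {
  tri_additive : is_additive C;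
  susp : autoequivalence C;
  dist : forall X Y Z : C, hom X Y -> hom Y Z -> hom Z (susp X) -> Prop;
  tri_iso : forall (X Y Z X' Y' Z' : C)
      (f : hom X Y) (g : hom Y Z) (h : hom Z (susp X))
      (f' : hom X' Y') (g' : hom Y' Z') (h' : hom Z' (susp X'))
      (a : hom X X') (b : hom Y Y') (c : hom Z Z'),
    is_iso a -> is_iso b -> is_iso c ->
    b \oc f = f' \oc a -> c \oc g = g' \oc b -> fmap susp a \oc h = h' \oc c ->
    dist f g h -> dist f' g' h';
  tri_id : forall X Z : C, is_zero Z ->
    dist (idc X) (0 : hom X Z) (0 : hom Z (susp X));
  tri_cone : forall (X Y : C) (f : hom X Y),
    exists (Z : C) (g : hom Y Z) (h : hom Z (susp X)), dist f g h;
  tri_rot : forall (X Y Z : C)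
      (f : hom X Y) (g : hom Y Z) (h : hom Z (susp X)),
    dist f g h <-> dist g h (- fmap susp f);
  tri_mor : forall (X Y Z X' Y' Z' : C)
      (f : hom X Y) (g : hom Y Z) (h : hom Z (susp X))
      (f' : hom X' Y') (g' : hom Y' Z') (h' : hom Z' (susp X'))
      (a : hom X X') (b : hom Y Y'),
    dist f g h -> dist f' g' h' -> b \oc f = f' \oc a ->
    exists c : hom Z Z', c \oc g = g' \oc b /\ fmap susp a \oc h = h' \oc c;
  tri_oct : forall (X Y Z X' Y' Z' : C) (u : hom X Y) (v : hom Y Z)
      (j : hom Y Z') (k : hom Z' (susp X))
      (l : hom Z X') (i : hom X' (susp Y))
      (m : hom Z Y') (n : hom Y' (susp X)),
    dist u j k -> dist v l i -> dist (v \oc u) m n ->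
    exists (f : hom Z' Y') (g : hom Y' X'),
      [/\ dist f g (fmap susp j \oc i), f \oc j = m \oc v, n \oc f = k,
          g \oc m = l & i \oc g = fmap susp u \oc n] }.

Arguments susp {C} t.
Arguments dist {C} t {X Y Z} f g h.

Definition is_triangle_functor (C D : preadditive)
    (tC : triangulation C) (tD : triangulation D) (P : functor C D) : Prop :=
  exists phi : natiso (comp_functor P (susp tC)) (comp_functor (susp tD) P),
    forall (X Y Z : C) (f : hom X Y) (g : hom Y Z) (h : hom Z (susp tC X)),
      dist tC f g h -> dist tD (fmap P f) (fmap P g) (phi X \oc fmap P h).

Definition locally_finite (C : preadditive) : Prop :=
  forall X : C, indecomposable X ->
    exists2 A : set C, finite_set A &
      forall Y : C, indecomposable Y -> (exists f : hom X Y, f <> 0) ->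
        exists2 Y', A Y' & isomorphic Y Y'.

(* A full subcategory closed under isomorphism is given by its set of objects. *)
Definition is_subcategory (C : preadditive) (S : set C) : Prop :=
  forall X Y : C, isomorphic X Y -> S X -> S Y.

Definition contravariantly_finite (C : preadditive) (S : set C) : Prop :=
  forall Z : C, exists X : C, S X /\ exists f : hom X Z,
    forall X' : C, S X' -> forall g : hom X' Z, exists h : hom X' X, g = f \oc h.

Definition covariantly_finite (C : preadditive) (S : set C) : Prop :=
  forall Z : C, exists X : C, S X /\ exists f : hom Z X,
    forall X' : C, S X' -> forall g : hom Z X', exists h : hom X X', g = h \oc f.

Definition functorially_finite (C : preadditive) (S : set C) : Prop :=
  covariantly_finite S /\ contravariantly_finite S.

Definition Ext (C : preadditive) (t : triangulation C) (i : nat) (X Y : C) : zmodType :=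
  hom X (iter_functor i (susp t) Y).

Definition cluster_tilting (C : preadditive) (t : triangulation C) (m : nat)
    (S : set C) : Prop :=
  [/\ is_subcategory S,
      functorially_finite S,
      S = [set Z | forall i, (0 < i < m)%N ->
             forall X, S X -> forall e : Ext t i X Z, e = 0]
    & S = [set Z | forall i, (0 < i < m)%N ->
             forall X, S X -> forall e : Ext t i Z X, e = 0]].

(* The closure under isomorphism of the image of S. *)
Definition image_subcategory (C D : preadditive) (F : functor C D) (S : set C) : set D :=
  [set Y | exists2 X, S X & isomorphic (F X) Y].

Definition periodic (C : preadditive) (F : functor C C) (S : set C) : Prop :=
  image_subcategory F S = S.

Section DirectSum.
Variables (I : choiceType) (V : I -> zmodType).

(* The direct sum of the V i: finitely supported families. *)
Record dsum := DSum {
  dsfun :> forall i, V i;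
  dsum_fin : finite_set [set i | dsfun i <> 0] }.

Lemma dsum_ext (f g : dsum) : (forall i, f i = g i) -> f = g.
Proof.
case: f g => [f ff] [g fg] /= fgE.
have {}fgE : f = g by apply: functional_extensionality_dep.
by subst g; congr DSum; exact: Prop_irrelevance.
Qed.

HB.instance Definition _ := gen_eqMixin dsum.
HB.instance Definition _ := gen_choiceMixin dsum.

Definition dsum0 : dsum.
Proof.
exists (fun i => 0); apply: (sub_finite_set _ (finite_set0 I)).
by move=> i /=; case.
Defined.

Definition dsum_opp (f : dsum) : dsum.
Proof.
exists (fun i => - f i); apply: sub_finite_set (dsum_fin f) => i /= h fi.
by apply: h; rewrite fi oppr0.
Defined.

Definition dsum_add (f g : dsum) : dsum.
Proof.
exists (fun i => f i + g i).
have fin : finite_set ([set i | f i <> 0] `|` [set i | g i <> 0]).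
  by rewrite finite_setU; split; exact: dsum_fin.
apply: sub_finite_set fin => i /= h.
by case: (pselect (f i = 0)) => [fi|]; [right => gi; apply: h; rewrite fi gi addr0|left].
Defined.

Lemma dsum_addA : associative dsum_add.
Proof. by move=> f g h; apply: dsum_ext => i /=; rewrite addrA. Qed.
Lemma dsum_addC : commutative dsum_add.
Proof. by move=> f g; apply: dsum_ext => i /=; rewrite addrC. Qed.
Lemma dsum_add0 : left_id dsum0 dsum_add.
Proof. by move=> f; apply: dsum_ext => i /=; rewrite add0r. Qed.
Lemma dsum_addN : left_inverse dsum0 dsum_opp dsum_add.
Proof. by move=> f; apply: dsum_ext => i /=; rewrite addNr. Qed.

HB.instance Definition _ :=
  GRing.isZmodule.Build dsum dsum_addA dsum_addC dsum_add0 dsum_addN.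

Definition dsingle_fun (i : I) (v : V i) (j : I) : V j :=
  if @eqP _ i j is ReflectT e then eq_rect i V v j e else 0.

Lemma dsingle_funE i (v : V i) : dsingle_fun v i = v.
Proof. by rewrite /dsingle_fun; case: eqP => // e; rewrite (eq_axiomK e). Qed.

Lemma dsingle_fun0 i (v : V i) j : i <> j -> dsingle_fun v j = 0.
Proof. by rewrite /dsingle_fun; case: eqP. Qed.

Definition dsingle (i : I) (v : V i) : dsum.
Proof.
exists (dsingle_fun v); apply: (sub_finite_set _ (finite_set1 i)) => j /= h.
by apply/esym; apply: contra_notP h; exact: dsingle_fun0.
Defined.

Lemma dsingleD i (v w : V i) : dsingle (v + w) = dsingle v + dsingle w.
Proof.
apply: dsum_ext => j /=; rewrite /dsingle_fun; case: eqP => [e|_]; last by rewrite addr0.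
by case: j / e.
Qed.

Lemma dsingle0 i : dsingle (0 : V i) = 0.
Proof.
apply: dsum_ext => j /=; rewrite /dsingle_fun; case: eqP => [e|//].
by case: j / e.
Qed.

Lemma dsum_sumE (s : seq I) (F : I -> dsum) j :
  (\sum_(i <- s) F i : dsum) j = \sum_(i <- s) F i j.
Proof. by elim/big_rec2: _ => //= i y x _ <-. Qed.

Lemma dsum_ind (P : dsum -> Prop) :
  P 0 -> (forall f g, P f -> P g -> P (f + g)) -> (forall i v, P (@dsingle i v)) ->
  forall f, P f.
Proof.
move=> P0 PD P1 f.
have [s sE] : exists s : seq I, [set i | f i <> 0] = [set` s].
  exact/finite_seqP/dsum_fin.
have -> : f = \sum_(i <- undup s) dsingle (f i).
  apply: dsum_ext => j; rewrite dsum_sumE.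
  have [js|js] := boolP (j \in s).
    rewrite (big_rem j) ?mem_undup//= dsingle_funE big_seq big1 ?addr0// => i.
    rewrite mem_rem_uniq ?undup_uniq// inE => /andP[/eqP ij _].
    exact: dsingle_fun0.
  have /= fj : f j = 0.
    apply: contrapT => fj; have : [set` s] j by rewrite -sE.
    by move=> /= jjs; rewrite jjs in js.
  rewrite fj big_seq big1// => i; rewrite mem_undup => is_ /=.
  by apply: dsingle_fun0 => ij; rewrite -ij is_ in js.
by elim/big_rec: _ => // i x _; apply: PD.
Qed.

End DirectSum.

Lemma fsum_seq (I : choiceType) (V : zmodType) (s : seq I) (F : I -> V) :
  (forall i, i \notin s -> F i = 0) ->
  \sum_(i \in [set: I]) F i = \sum_(i <- undup s) F i.
Proof.
move=> F0; transitivity (\sum_(i \in [set` undup s]) F i).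
  rewrite [RHS]fsbig_mkcond; apply: eq_fsbigr => i _; rewrite /patch.
  case: ifPn => // h; apply: F0; apply: contra h => i_s.
  by apply/mem_set; rewrite /= mem_undup.
by rewrite -fsbig_seq ?undup_uniq.
Qed.

Lemma dsum_supp (I : choiceType) (V : I -> zmodType) (f : dsum V) :
  exists s : seq I, forall i, i \notin s -> f i = 0.
Proof.
have [s sE] : exists s : seq I, [set i | f i <> 0] = [set` s].
  exact/finite_seqP/dsum_fin.
exists s => i i_s; apply: contrapT => fi.
have : [set` s] i by rewrite -sE.
by move=> /= is'; rewrite is' in i_s.
Qed.

Section IsoLemmas.
Context {C : preadditive}.

Lemma iso_idc (X : C) : is_iso (idc X).
Proof. by exists (idc X); rewrite comp1c. Qed.

Lemma iso_comp (X Y Z : C) (g : hom Y Z) (f : hom X Y) :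
  is_iso g -> is_iso f -> is_iso (g \oc f).
Proof.
move=> [g' [gK Kg]] [f' [fK Kf]]; exists (f' \oc g'); split.
  by rewrite -compA (compA g') gK comp1c.
by rewrite -compA (compA f) Kf comp1c.
Qed.

Lemma iso_fmap (D : preadditive) (P : functor C D) (X Y : C) (f : hom X Y) :
  is_iso f -> is_iso (fmap P f).
Proof. by move=> [g [gK Kg]]; exists (fmap P g); rewrite -!fmap_comp gK Kg !fmap1. Qed.

Lemma iso_nt (B : preadditive) (P Q : functor B C) (a : natiso P Q) X : is_iso (a X).
Proof. by exists (nt_inv a X); rewrite nt_invK nt_Kinv. Qed.

Lemma iso_nt_inv (B : preadditive) (P Q : functor B C) (a : natiso P Q) X :
  is_iso (nt_inv a X).
Proof. by exists (a X); rewrite nt_invK nt_Kinv. Qed.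

Lemma iso_epi (X Y Z : C) (a : hom X Y) (f g : hom Y Z) :
  is_iso a -> f \oc a = g \oc a -> f = g.
Proof. by move=> [b [_ Kb]] /(congr1 (fun h => h \oc b)); rewrite -!compA Kb !compc1. Qed.

Lemma iso_mono (X Y Z : C) (a : hom Y Z) (f g : hom X Y) :
  is_iso a -> a \oc f = a \oc g -> f = g.
Proof. by move=> [b [bK _]] /(congr1 (fun h => b \oc h)); rewrite !compA bK !comp1c. Qed.

Lemma nt_inv_natural (B : preadditive) (P Q : functor B C) (a : natiso P Q) X Y
    (f : hom X Y) : nt_inv a Y \oc fmap Q f = fmap P f \oc nt_inv a X.
Proof.
apply: (iso_mono (iso_nt a Y)); rewrite !compA nt_Kinv comp1c nt_natural.
by rewrite -compA nt_Kinv compc1.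
Qed.

Lemma comp0c (X Y Z : C) (f : hom X Y) : (0 : hom Y Z) \oc f = 0.
Proof. by apply: (addrI (0 \oc f)); rewrite -compDl !addr0. Qed.

Lemma compc0 (X Y Z : C) (g : hom Y Z) : g \oc (0 : hom X Y) = 0.
Proof. by apply: (addrI (g \oc 0)); rewrite -compDr !addr0. Qed.

Lemma fmap0 (D : preadditive) (P : functor C D) (X Y : C) : fmap P (0 : hom X Y) = 0.
Proof. by apply: (addrI (fmap P 0)); rewrite -fmapD !addr0. Qed.

End IsoLemmas.

Definition zsucc (p : int) : int :=
  match p with Posz n => Posz n.+1 | Negz 0 => Posz 0 | Negz n.+1 => Negz n end.

Definition zpred (p : int) : int :=
  match p with Posz 0 => Negz 0 | Posz n.+1 => Posz n | Negz n => Negz n.+1 end.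

Lemma zsuccE p : zsucc p = p + 1.
Proof. by case: p => [n|[|n]] //=; lia. Qed.

Lemma zpredE p : zpred p = p - 1.
Proof. by case: p => [[|n]|n] //=; lia. Qed.

Lemma zsucc_ind (P : int -> Prop) :
  P 0 -> (forall p, P p <-> P (zsucc p)) -> forall p, P p.
Proof.
move=> P0 PS; case=> n; first by elim: n => // n /PS.
by elim: n => [|n IHn]; apply/PS.
Qed.

Section Powers.
Variables (C : preadditive) (F : autoequivalence C).
Local Notation G := (aeq_inv F).
Local Notation eta := (aeq_unit F).
Local Notation eps := (aeq_counit F).

Lemma aeq_faithful (X Y : C) (f g : hom X Y) : fmap F f = fmap F g -> f = g.
Proof.
move=> fg; apply: (iso_mono (iso_nt eta Y)).
by move: (nt_natural eta f) (nt_natural eta g) => /= -> ->; rewrite fg.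
Qed.

(* The counit replaced by the one which, together with the given unit,
   satisfies the triangle identities. *)
Definition counit (Y : C) : hom (F (G Y)) Y :=
  eps Y \oc fmap F (nt_inv eta (G Y)) \oc nt_inv eps (F (G Y)).

Lemma counit_iso Y : is_iso (counit Y).
Proof.
apply: iso_comp; last exact: (iso_nt_inv eps).
apply: iso_comp; first exact: (iso_nt eps).
exact/iso_fmap/(iso_nt_inv eta).
Qed.

Lemma counit_natural X Y (f : hom X Y) :
  counit Y \oc fmap F (fmap G f) = f \oc counit X.
Proof.
have h1 := nt_inv_natural eps (fmap F (fmap G f)).
have h2 := nt_inv_natural eta (fmap G f).
have h3 := nt_natural eps f.
rewrite /= in h1 h2 h3.
rewrite /counit /= -compA h1 compA -[eps Y \oc _ \oc _]compA -fmap_comp h2.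
by rewrite fmap_comp !compA h3.
Qed.

Lemma counit_triangle X : counit (F X) = fmap F (nt_inv eta X).
Proof.
have iE : is_iso (fmap F (eta X)) by exact/iso_fmap/(iso_nt eta).
apply: (iso_epi iE); rewrite -fmap_comp nt_invK fmap1 /counit /= -!compA.
have h1 := nt_inv_natural eps (fmap F (eta X)); rewrite /= in h1; rewrite h1.
have e : fmap G (fmap F (eta X)) = eta (G (F X)).
  apply: (iso_epi (iso_nt eta X)).
  by rewrite -[LHS](nt_natural eta (eta X)).
have k := nt_invK eta (G (F X)); rewrite /= in k.
rewrite e /= (compA (fmap F (nt_inv eta (G (F X))))) -fmap_comp k fmap1 comp1c.
exact: (nt_Kinv eps).
Qed.

Definition zpow (p : int) : functor C C :=
  match p with
  | Posz n => iter_functor n F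
  | Negz n => iter_functor n.+1 G
  end.

Definition zcast (p q : int) (e : p = q) (X : C) : hom (zpow p X) (zpow q X) :=
  eq_rect p (fun r => hom (zpow p X) (zpow r X)) (idc _) q e.

Lemma zcast_id p (e : p = p) X : zcast e X = idc _.
Proof. by rewrite (eq_axiomK e). Qed.

Lemma zcast_natural p q (e : p = q) X Y (f : hom X Y) :
  fmap (zpow q) f \oc zcast e X = zcast e Y \oc fmap (zpow p) f.
Proof. by case: q / e; rewrite /= comp1c compc1. Qed.

Definition zshift (p : int) (X : C) : hom (F (zpow p X)) (zpow (zsucc p) X) :=
  match p return hom (F (zpow p X)) (zpow (zsucc p) X) with
  | Posz n => idc _
  | Negz 0 => counit X
  | Negz n.+1 => counit (zpow (Negz n) X)
  end.

Definition zunshift (p : int) (X : C) : hom (G (zpow p X)) (zpow (zpred p) X) :=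
  match p return hom (G (zpow p X)) (zpow (zpred p) X) with
  | Posz 0 => idc _
  | Posz n.+1 => nt_inv eta (zpow (Posz n) X)
  | Negz n => idc _
  end.

Lemma zshift_iso p X : is_iso (zshift p X).
Proof. by case: p => [n|[|n]]; [exact: iso_idc|exact: counit_iso..]. Qed.

Lemma zshift_natural p X Y (f : hom X Y) :
  fmap (zpow (zsucc p)) f \oc zshift p X = zshift p Y \oc fmap F (fmap (zpow p) f).
Proof.
case: p => [n|[|n]] /=; first by rewrite comp1c compc1.
  by rewrite counit_natural.
by rewrite [RHS]counit_natural.
Qed.

Lemma zunshift_natural p X Y (f : hom X Y) :
  fmap (zpow (zpred p)) f \oc zunshift p X =
    zunshift p Y \oc fmap G (fmap (zpow p) f).
Proof.
case: p => [[|n]|n] /=; try by rewrite comp1c compc1.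
by rewrite [RHS](nt_inv_natural eta).
Qed.

Lemma zsucc_add (p q : int) : zsucc (p + q) = zsucc p + q.
Proof. by rewrite !zsuccE addrAC. Qed.

Lemma zpred_add (p q : int) : zpred (p + q) = zpred p + q.
Proof. by rewrite !zpredE addrAC. Qed.

Lemma zpred_oppn (n : nat) (q : int) : zpred (- n%:Z + q) = - n.+1%:Z + q.
Proof. by rewrite zpredE; lia. Qed.

Fixpoint mu_pos (n : nat) (q : int) (X : C) :
    hom (iter_functor n F (zpow q X)) (zpow (n%:Z + q) X) :=
  match n return hom (iter_functor n F (zpow q X)) (zpow (n%:Z + q) X) with
  | 0%N => zcast (esym (add0r q)) X
  | n'.+1 => zcast (zsucc_add n' q) X \oc (zshift (n'%:Z + q) X
               \oc fmap F (mu_pos n' q X))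
  end.

Fixpoint mu_neg (n : nat) (q : int) (X : C) :
    hom (iter_functor n G (zpow q X)) (zpow (- n%:Z + q) X) :=
  match n return hom (iter_functor n G (zpow q X)) (zpow (- n%:Z + q) X) with
  | 0%N => zcast (esym (add0r q)) X
  | n'.+1 => zcast (zpred_oppn n' q) X \oc (zunshift (- n'%:Z + q) X
               \oc fmap G (mu_neg n' q X))
  end.

(* The canonical isomorphism F^p F^q = F^(p+q), obtained by cancelling F against
   its quasi-inverse with the unit and the counit; see [mu_assoc] for coherence. *)
Definition mu (p q : int) (X : C) : hom (zpow p (zpow q X)) (zpow (p + q) X) :=
  match p return hom (zpow p (zpow q X)) (zpow (p + q) X) with
  | Posz n => mu_pos n q X
  | Negz n => mu_neg n.+1 q X
  end.

(* Equality up to an equality of the exponents of the codomains. *)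
Definition zeq (A X : C) (s t : int) (f : hom A (zpow s X)) (g : hom A (zpow t X)) :=
  exists e : s = t, zcast e X \oc f = g.

Lemma zeq_refl A X s (f : hom A (zpow s X)) : zeq f f.
Proof. by exists erefl; rewrite /= comp1c. Qed.

Lemma zeq_sym A X s t (f : hom A (zpow s X)) (g : hom A (zpow t X)) :
  zeq f g -> zeq g f.
Proof. by move=> [e <-]; case: t / e g => g /=; rewrite comp1c; exact: zeq_refl. Qed.

Lemma zeq_trans A X s t u (f : hom A (zpow s X)) (g : hom A (zpow t X))
    (h : hom A (zpow u X)) : zeq f g -> zeq g h -> zeq f h.
Proof. by move=> [e <-]; case: t / e g => g /=; rewrite comp1c. Qed.

Lemma zeq_cast A X s t (e : s = t) (f : hom A (zpow s X)) : zeq f (zcast e X \oc f).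
Proof. by exists e. Qed.

Lemma zeq_eq A X s (f g : hom A (zpow s X)) : zeq f g -> f = g.
Proof. by move=> [e <-]; rewrite zcast_id comp1c. Qed.

Lemma zeq_comp A B X s t (f : hom A (zpow s X)) (g : hom A (zpow t X)) (a : hom B A) :
  zeq f g -> zeq (f \oc a) (g \oc a).
Proof. by move=> [e <-]; exists e; rewrite compA. Qed.

Lemma zeq_shift A X s t (f : hom A (zpow s X)) (g : hom A (zpow t X)) :
  zeq f g -> zeq (zshift s X \oc fmap F f) (zshift t X \oc fmap F g).
Proof. by move=> [e <-]; case: t / e g => g /=; rewrite comp1c; exact: zeq_refl. Qed.

Lemma zeq_mu A X s t r (f : hom A (zpow s (zpow r X))) (g : hom A (zpow t (zpow r X))) :
  zeq f g -> zeq (mu s r X \oc f) (mu t r X \oc g).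
Proof. by move=> [e <-]; case: t / e g => g /=; rewrite comp1c; exact: zeq_refl. Qed.

Lemma zshift_unshift s X :
  zeq (zshift (zpred s) X \oc fmap F (zunshift s X)) (counit (zpow s X)).
Proof.
case: s => [[|n]|n]; exists erefl; rewrite /= comp1c.
- by rewrite fmap1 compc1.
- by rewrite comp1c counit_triangle.
- by rewrite fmap1 compc1.
Qed.

Lemma mu_neg_natural n q X Y (f : hom X Y) :
  fmap (zpow (- n%:Z + q)) f \oc mu_neg n q X =
    mu_neg n q Y \oc fmap (iter_functor n G) (fmap (zpow q) f).
Proof.
elim: n => [|n IHn] /=; first exact: zcast_natural.
rewrite compA zcast_natural -!compA; congr (_ \oc _).
by rewrite compA zunshift_natural -!compA -!fmap_comp IHn.
Qed.

Lemma mu_natural p q X Y (f : hom X Y) :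
  fmap (zpow (p + q)) f \oc mu p q X = mu p q Y \oc fmap (zpow p) (fmap (zpow q) f).
Proof.
case: p => n; last exact: (mu_neg_natural n.+1).
elim: n => [|n IHn] /=; first exact: zcast_natural.
rewrite compA zcast_natural -!compA; congr (_ \oc _).
rewrite compA zshift_natural -!compA -!fmap_comp; congr (_ \oc fmap _ _).
exact: IHn.
Qed.

Lemma mu_neg_step n q X :
  zeq (mu_neg n q X \oc counit (iter_functor n G (zpow q X)))
      (zshift (- n.+1%:Z + q) X \oc fmap F (mu_neg n.+1 q X)).
Proof.
have h : zeq (zunshift (- n%:Z + q) X \oc fmap G (mu_neg n q X)) (mu_neg n.+1 q X).
  exact: zeq_cast.
apply: zeq_trans (zeq_shift h); rewrite fmap_comp compA -counit_natural.
exact/zeq_comp/zeq_sym/zshift_unshift.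
Qed.

Lemma mu_step p q X :
  zeq (mu (zsucc p) q X \oc zshift p (zpow q X)) (zshift (p + q) X \oc fmap F (mu p q X)).
Proof.
case: p => [n|[|n]].
- by rewrite /= compc1; exact/zeq_sym/zeq_cast.
- exact: (mu_neg_step 0).
- exact: (mu_neg_step n.+1).
Qed.

Lemma zeq_step A A' X s t s' t' (a : hom (F A) A') (f : hom A (zpow s X))
    (g : hom A (zpow t X)) (f' : hom A' (zpow s' X)) (g' : hom A' (zpow t' X)) :
  is_iso a ->
  zeq (f' \oc a) (zshift s X \oc fmap F f) ->
  zeq (g' \oc a) (zshift t X \oc fmap F g) ->
  zeq f g <-> zeq f' g'.
Proof.
move=> ia ff gg; split=> [/zeq_shift fg | [e fg]].
  have [e fg'] := zeq_trans ff (zeq_trans fg (zeq_sym gg)).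
  by exists e; apply: (iso_epi ia); rewrite -compA.
have /zeq_comp fg' : zeq f' g' by exists e.
have [e' {}fg'] := zeq_trans (zeq_sym ff) (zeq_trans (fg' _ a) gg).
have est : s = t by move: (e'); rewrite !zsuccE => /addIr.
subst t; exists erefl; rewrite comp1c; apply: aeq_faithful.
apply: (iso_mono (zshift_iso s X)).
by move: fg'; rewrite zcast_id comp1c.
Qed.

Lemma mu_assoc p q r X :
  zeq (mu (p + q) r X \oc mu p q (zpow r X))
      (mu p (q + r) X \oc fmap (zpow p) (mu q r X)).
Proof.
elim/zsucc_ind: p => [|p].
  have h : zeq (idc (zpow q (zpow r X))) (mu 0 q (zpow r X)).
    by rewrite -[mu _ _ _]compc1; exact: zeq_cast.
  apply: zeq_trans (zeq_mu (zeq_sym h)) _; rewrite compc1.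
  exact: zeq_cast.
apply: (zeq_step (zshift_iso p _)).
  rewrite -compA; apply: zeq_trans (zeq_mu (mu_step p q (zpow r X))) _.
  by rewrite fmap_comp !compA; exact/zeq_comp/mu_step.
rewrite -compA zshift_natural compA fmap_comp compA.
exact/zeq_comp/mu_step.
Qed.

Lemma mu0 q X : zeq (idc (zpow q X)) (mu 0 q X).
Proof. by rewrite -[mu _ _ _]compc1; exact: zeq_cast. Qed.

Lemma mu_0 p X : zeq (idc (zpow p X)) (mu p 0 X).
Proof.
elim/zsucc_ind: p => [|p]; first exact: mu0.
apply: (zeq_step (zshift_iso p _)); last exact: mu_step.
by rewrite comp1c fmap1 compc1; exact: zeq_refl.
Qed.

Definition orbit_hom (X Y : C) : zmodType := dsum (fun p : int => hom X (zpow p Y)).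

Lemma zeq_dsingle X Y s t (f : hom X (zpow s Y)) (g : hom X (zpow t Y)) :
  zeq f g -> dsingle f = dsingle g :> orbit_hom X Y.
Proof. by move=> [e <-]; case: t / e g => g; rewrite comp1c. Qed.

Definition hcomp (X Y Z : C) (p q : int) (g : hom Y (zpow q Z)) (f : hom X (zpow p Y)) :
    hom X (zpow (p + q) Z) :=
  mu p q Z \oc fmap (zpow p) g \oc f.

Lemma hcompA X Y Z W p q r (h : hom Z (zpow r W)) (g : hom Y (zpow q Z))
    (f : hom X (zpow p Y)) : zeq (hcomp (hcomp h g) f) (hcomp h (hcomp g f)).
Proof.
rewrite /hcomp !fmap_comp !compA.
do 2!apply: zeq_comp; rewrite -[X in zeq _ X]compA mu_natural compA.
exact/zeq_comp/zeq_sym/mu_assoc.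
Qed.

Definition orbit_id (X : C) : orbit_hom X X := dsingle (idc X : hom X (zpow 0 X)).

Definition orbit_comp (X Y Z : C) (g : orbit_hom Y Z) (f : orbit_hom X Y) :
    orbit_hom X Z :=
  \sum_(p \in [set: int]) \sum_(q \in [set: int])
    (dsingle (hcomp (g q) (f p)) : orbit_hom X Z).

Lemma orbit_compE (X Y Z : C) (g : orbit_hom Y Z) (f : orbit_hom X Y) (s t : seq int) :
  (forall p, p \notin s -> f p = 0) -> (forall q, q \notin t -> g q = 0) ->
  orbit_comp g f =
    \sum_(p <- undup s) \sum_(q <- undup t) (dsingle (hcomp (g q) (f p)) : orbit_hom X Z).
Proof.
move=> f0 g0; rewrite /orbit_comp (@fsum_seq _ _ s) => [|p /f0 fp].
  apply: eq_bigr => p _; apply: fsum_seq => q /g0 gq.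
  by rewrite gq /hcomp fmap0 compc0 comp0c dsingle0.
by rewrite fsbig1// => q _; rewrite fp /hcomp compc0 dsingle0.
Qed.

Lemma orbit_compDl (X Y Z : C) (g g' : orbit_hom Y Z) (f : orbit_hom X Y) :
  orbit_comp (g + g') f = orbit_comp g f + orbit_comp g' f.
Proof.
have [s fs] := dsum_supp f.
have [t gt] := dsum_supp g; have [t' gt'] := dsum_supp g'.
have h q : q \notin t ++ t' -> g q = 0 /\ g' q = 0.
  by rewrite mem_cat => /norP[/gt ? /gt' ?].
rewrite !(@orbit_compE _ _ _ _ f s (t ++ t')) //; try by move=> q /h[].
  rewrite -big_split; apply: eq_bigr => p _ /=.
  rewrite -big_split; apply: eq_bigr => q _ /=.
  by rewrite /hcomp fmapD compDr compDl dsingleD.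
by move=> q /h[gq gq'] /=; rewrite gq gq' addr0.
Qed.

Lemma orbit_compDr (X Y Z : C) (g : orbit_hom Y Z) (f f' : orbit_hom X Y) :
  orbit_comp g (f + f') = orbit_comp g f + orbit_comp g f'.
Proof.
have [t gt] := dsum_supp g.
have [s fs] := dsum_supp f; have [s' fs'] := dsum_supp f'.
have h q : q \notin s ++ s' -> f q = 0 /\ f' q = 0.
  by rewrite mem_cat => /norP[/fs ? /fs' ?].
rewrite !(@orbit_compE _ _ _ g _ (s ++ s') t) //; try by move=> q /h[].
  rewrite -big_split; apply: eq_bigr => p _ /=.
  rewrite -big_split; apply: eq_bigr => q _ /=.
  by rewrite /hcomp compDr dsingleD.
by move=> q /h[gq gq'] /=; rewrite gq gq' addr0.
Qed.

Lemma orbit_comp0l (X Y Z : C) (f : orbit_hom X Y) : orbit_comp (0 : orbit_hom Y Z) f = 0.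
Proof. by apply: (addrI (orbit_comp 0 f)); rewrite -orbit_compDl !addr0. Qed.

Lemma orbit_comp0r (X Y Z : C) (g : orbit_hom Y Z) : orbit_comp g (0 : orbit_hom X Y) = 0.
Proof. by apply: (addrI (orbit_comp g 0)); rewrite -orbit_compDr !addr0. Qed.

Lemma orbit_comp_dsingle (X Y Z : C) p q (g : hom Y (zpow q Z)) (f : hom X (zpow p Y)) :
  orbit_comp (dsingle g : orbit_hom Y Z) (dsingle f : orbit_hom X Y) =
    dsingle (hcomp g f).
Proof.
rewrite (@orbit_compE _ _ _ _ _ [:: p] [:: q]) => [|r|r].
- by rewrite /= !big_seq1 /= !dsingle_funE.
- by rewrite inE => /eqP rp; apply: dsingle_fun0 => pr; apply: rp.
- by rewrite inE => /eqP rp; apply: dsingle_fun0 => pr; apply: rp.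
Qed.

Lemma orbit_compA (X Y Z W : C) (h : orbit_hom Z W) (g : orbit_hom Y Z)
    (f : orbit_hom X Y) :
  orbit_comp h (orbit_comp g f) = orbit_comp (orbit_comp h g) f.
Proof.
elim/dsum_ind: f => [|f f' IH IH'|p f]; first by rewrite !orbit_comp0r.
  by rewrite !orbit_compDr IH IH'.
elim/dsum_ind: g => [|g g' IH IH'|q g].
- by rewrite orbit_comp0l !orbit_comp0r orbit_comp0l.
- by rewrite orbit_compDl !orbit_compDr orbit_compDl IH IH'.
elim/dsum_ind: h => [|h h' IH IH'|r h]; first by rewrite !orbit_comp0l.
  by rewrite !orbit_compDl IH IH'.
by rewrite !orbit_comp_dsingle; exact/esym/zeq_dsingle/hcompA.
Qed.

Lemma orbit_comp1l (X Y : C) (f : orbit_hom X Y) : orbit_comp (orbit_id Y) f = f.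
Proof.
elim/dsum_ind: f => [|f g IH IH'|p f]; first by rewrite orbit_comp0r.
  by rewrite orbit_compDr IH IH'.
rewrite orbit_comp_dsingle; apply/esym/zeq_dsingle.
by rewrite /hcomp fmap1 compc1 -{1}[f]comp1c; exact/zeq_comp/mu_0.
Qed.

Lemma orbit_comp1r (X Y : C) (f : orbit_hom X Y) : orbit_comp f (orbit_id X) = f.
Proof.
elim/dsum_ind: f => [|f g IH IH'|p f]; first by rewrite orbit_comp0l.
  by rewrite orbit_compDl IH IH'.
rewrite orbit_comp_dsingle; apply/esym/zeq_dsingle.
by rewrite /hcomp compc1 -{1}[f]comp1c; exact/zeq_comp/mu0.
Qed.

Definition orbit_category : preadditive :=
  Preadditive orbit_compA orbit_comp1l orbit_comp1r orbit_compDl orbit_compDr.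

Lemma orbit_projD (X Y : C) (f g : hom X Y) :
  dsingle (f + g : hom X (zpow 0 Y)) =
    dsingle (f : hom X (zpow 0 Y)) + dsingle (g : hom X (zpow 0 Y)) :> orbit_hom X Y.
Proof. exact: dsingleD. Qed.

Lemma orbit_proj_comp (X Y Z : C) (g : hom Y Z) (f : hom X Y) :
  dsingle (g \oc f : hom X (zpow 0 Z)) =
    orbit_comp (dsingle (g : hom Y (zpow 0 Z)) : orbit_hom Y Z)
               (dsingle (f : hom X (zpow 0 Y)) : orbit_hom X Y) :> orbit_hom X Z.
Proof.
rewrite orbit_comp_dsingle; apply: zeq_dsingle.
have := @zeq_comp (zpow 0 Z) X Z _ _ _ _ (g \oc f) (mu0 0 Z).
by rewrite comp1c /hcomp -[X in _ -> zeq _ X]compA.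
Qed.

(* [zpow 0] is the identity functor, so [hom X (zpow 0 Y)] is [hom X Y]. *)
Definition orbit_proj : functor C orbit_category :=
  @Functor C orbit_category (fun X => X)
    (fun X Y f => dsingle (f : hom X (zpow 0 Y)))
    (fun X => erefl) orbit_proj_comp orbit_projD.

End Powers.

(* Main.v *)
(* The bijection is the identity on sets of objects, T and its orbit category O
   having the same objects. In O every X is isomorphic to F X, so the sets closed
   under isomorphism in O are F-periodic, and if S is F-periodic every morphism of
   O from an object of S to W is a sum of morphisms which factor as a morphism of O
   followed by the projection of a morphism X' -> W of T with X' in S. Hence Ext
   out of S vanishes in T iff it does in O. For Ext into S, F^p Sigma^i X is
   Sigma^i X' for some X', and X' is isomorphic to X in O, hence lies in S.
   An approximation in O yields one in T by taking the finite direct sum of its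
   homogeneous components, translated to degree 0. *)
From mathcomp Require Import all_boot all_order all_algebra.
From mathcomp Require Import boolp classical_sets functions.
Require Import Defs.

Local Open Scope classical_set_scope.

Set Implicit Arguments.
Unset Strict Implicit.
Unset Printing Implicit Defensive.

Import GRing.Theory.
Local Open Scope ring_scope.
Local Open Scope cat_scope.

(** * Isomorphic objects and vanishing of morphisms *)

Section Preadditive.
Context {C : preadditive}.

Lemma isomorphic_sym (X Y : C) : isomorphic X Y -> isomorphic Y X.
Proof. by move=> [f [g [gf fg]]]; exists g, f. Qed.

Lemma isomorphic_trans (Y X Z : C) :
  isomorphic X Y -> isomorphic Y Z -> isomorphic X Z.
Proof. by move=> [f fi] [g gi]; exists (g \oc f); exact: iso_comp. Qed.

Lemma isomorphic_fmap (D : preadditive) (P : functor C D) (X Y : C) :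
  isomorphic X Y -> isomorphic (P X) (P Y).
Proof. by move=> [f fi]; exists (fmap P f); exact: iso_fmap. Qed.

Lemma isomorphic_nt (B : preadditive) (P Q : functor B C) (a : natiso P Q) X :
  isomorphic (P X) (Q X).
Proof. by exists (a X); exact: iso_nt. Qed.

Lemma hom0_isomorphic (X Y Y' : C) : isomorphic Y Y' ->
  (forall e : hom X Y, e = 0) -> forall e : hom X Y', e = 0.
Proof.
move=> [f [g [_ fg]]] h e.
by rewrite -[e]comp1c -fg -compA (h (g \oc e)) compc0.
Qed.

(** * Autoequivalences and periodic subcategories *)

Section Autoequivalence.
Variable F : autoequivalence C.

Lemma isomorphic_unit X : isomorphic X (aeq_inv F (F X)).
Proof. exact: (isomorphic_nt (aeq_unit F)). Qed.

Lemma isomorphic_counit X : isomorphic (F (aeq_inv F X)) X.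
Proof. exact: (isomorphic_nt (aeq_counit F)). Qed.

Lemma aeq_isomorphic X Y : isomorphic (F X) (F Y) -> isomorphic X Y.
Proof.
move=> /(isomorphic_fmap (aeq_inv F)) h.
apply: isomorphic_trans (isomorphic_unit X) _.
exact: isomorphic_trans h (isomorphic_sym (isomorphic_unit Y)).
Qed.

Lemma iter_aeq_isomorphic n X Y :
  isomorphic (iter_functor n F X) (iter_functor n F Y) -> isomorphic X Y.
Proof. by elim: n => // n IHn /aeq_isomorphic/IHn. Qed.

Lemma iter_aeq_surj n Y : exists X, isomorphic (iter_functor n F X) Y.
Proof.
elim: n Y => [|n IHn] Y; first by exists Y, (idc Y); exact: iso_idc.
have [X XY] := IHn (aeq_inv F Y); exists X.
exact: isomorphic_trans (isomorphic_fmap F XY) (isomorphic_counit Y).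
Qed.

Lemma periodic_aeq (S : set C) X : periodic F S -> S X -> S (F X).
Proof.
move=> Sper SX; rewrite -Sper.
by exists X => //; exists (idc (F X)); exact: iso_idc.
Qed.

(** Periodicity gives X isomorphic to F Y with Y in S, and the unit identifies the quasi-inverse
    applied to F Y with Y. *)
Lemma periodic_inv (S : set C) X : is_subcategory S -> periodic F S ->
  S X -> S (aeq_inv F X).
Proof.
move=> Ssub Sper; rewrite -{1}Sper => -[Y SY FYX].
apply: Ssub SY; apply: isomorphic_trans (isomorphic_unit Y) _.
exact: isomorphic_fmap.
Qed.

Lemma periodic_zpow (S : set C) p X : is_subcategory S -> periodic F S ->
  S X -> S (zpow F p X).
Proof.
move=> Ssub Sper SX.
have iterS (P : functor C C) n : (forall Y, S Y -> S (P Y)) -> S (iter_functor n P X).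
  by move=> SP; elim: n => //= n; exact: SP.
by case: p => n; apply: iterS => Y; [exact: periodic_aeq|exact: periodic_inv].
Qed.

End Autoequivalence.

(** * Factoring finite families of morphisms through one object *)

Lemma factor_sum (I : Type) (s : seq I) (P : pred I) (X A Y : C) (a : hom A Y)
    (v : I -> hom X Y) :
  (forall i, P i -> exists u, v i = a \oc u) ->
  exists u, \sum_(i <- s | P i) v i = a \oc u.
Proof.
move=> h; elim/big_ind: _ => [|_ _ [u ->] [u' ->]|//].
  by exists 0; rewrite compc0.
by exists (u + u'); rewrite compDr.
Qed.

Lemma cofactor_sum (I : Type) (s : seq I) (P : pred I) (X A Y : C) (a : hom X A)
    (v : I -> hom X Y) :
  (forall i, P i -> exists u, v i = u \oc a) ->
  exists u, \sum_(i <- s | P i) v i = u \oc a.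
Proof.
move=> h; elim/big_ind: _ => [|_ _ [u ->] [u' ->]|//].
  by exists 0; rewrite comp0c.
by exists (u + u'); rewrite compDl.
Qed.

Definition sum_closed (S : set C) : Prop :=
  (forall Z, is_zero Z -> S Z) /\
  forall A B Z, is_biproduct A B Z -> S A -> S B -> S Z.

(** Adding one biproduct at a time assembles finitely many morphisms into Z into a single one. This
    turns the components of an approximation in the orbit category into one morphism of T. *)
Lemma sum_closed_factor (I : eqType) (S : set C) (Z : C) (A : I -> C)
    (a : forall i, hom (A i) Z) (s : seq I) :
  is_additive C -> sum_closed S -> (forall i, S (A i)) ->
  exists2 X, S X & exists f : hom X Z,
    forall i, i \in s -> exists u, a i = f \oc u.
Proof.
move=> [[O O0] Cadd] [S0 SD] SA.
elim: s => [|i s [X SX [f fP]]]; first by exists O; [exact: S0|exists 0].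
have [Y XY] := Cadd (A i) X; exists Y; first exact: SD XY (SA i) SX.
have [k [l [p [q [pk ql pl qk _]]]]] := XY.
exists (a i \oc p + f \oc q) => j; rewrite inE => /predU1P[->|/fP[u ->]].
  by exists k; rewrite compDl -!compA pk qk compc0 addr0 compc1.
exists (l \oc u).
by rewrite compDl -!compA !(compA _ l) pl ql comp0c compc0 add0r comp1c.
Qed.

Lemma sum_closed_cofactor (I : eqType) (S : set C) (Z : C) (A : I -> C)
    (a : forall i, hom Z (A i)) (s : seq I) :
  is_additive C -> sum_closed S -> (forall i, S (A i)) ->
  exists2 X, S X & exists f : hom Z X,
    forall i, i \in s -> exists u, a i = u \oc f.
Proof.
move=> [[O O0] Cadd] [S0 SD] SA.
elim: s => [|i s [X SX [f fP]]]; first by exists O; [exact: S0|exists 0].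
have [Y XY] := Cadd (A i) X; exists Y; first exact: SD XY (SA i) SX.
have [k [l [p [q [pk ql pl qk _]]]]] := XY.
exists (k \oc a i + l \oc f) => j; rewrite inE => /predU1P[->|/fP[u ->]].
  by exists p; rewrite compDr !compA pk pl comp0c addr0 comp1c.
exists (u \oc q).
by rewrite -compA compDr !(compA q) qk ql comp0c add0r comp1c.
Qed.

(** * Ext-perpendicular subcategories *)

Section Perpendicular.
Variables (t : triangulation C) (m : nat) (S : set C).

Definition right_perp : set C :=
  [set Z | forall i, (0 < i < m)%N -> forall X, S X -> forall e : Ext t i X Z, e = 0].

Definition left_perp : set C :=
  [set Z | forall i, (0 < i < m)%N -> forall X, S X -> forall e : Ext t i Z X, e = 0].

Lemma right_perp_isomorphic : is_subcategory right_perp.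
Proof.
move=> X Y XY hX i im W SW.
by apply: hom0_isomorphic (hX i im W SW); exact: isomorphic_fmap.
Qed.

Lemma right_perp_sum_closed : sum_closed right_perp.
Proof.
split=> [Z Z0 i im X SX e|A B Z [k [l [p [q [_ _ _ _ kl]]]]] hA hB i im X SX e].
  rewrite -[e]comp1c -fmap1 (_ : idc Z = 0) ?fmap0 ?comp0c//.
  by case: (Z0 Z) => /(_ (idc Z)).
(* Splitting the identity of Z writes e as a sum of two morphisms, factoring through the shifts of A
   and of B. *)
rewrite -[e]comp1c -fmap1 -kl fmapD !fmap_comp compDl -!compA.
by rewrite (hA i im X SX (fmap _ p \oc e)) (hB i im X SX (fmap _ q \oc e)) !compc0 addr0.
Qed.

Lemma right_perp_left : S = right_perp -> S `<=` left_perp.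
Proof. by move=> SE Z SZ i im X SX; move: SX; rewrite SE; apply. Qed.

End Perpendicular.
End Preadditive.

(** * Objects and homogeneous morphisms of the orbit category *)

Section Orbit.
Variables (T : preadditive) (F : autoequivalence T).
Notation O := (orbit_category F).
Notation pr := (fmap (orbit_proj F)).

(** [orbit_down], of degree 1, and [orbit_up], of degree -1, will be mutually inverse in O. *)
Definition orbit_down (X : T) : hom (F X : O) (X : O) :=
  dsingle (idc (F X) : hom (F X) (zpow F 1 X)).

Definition orbit_up (X : T) : hom (X : O) (F X : O) :=
  dsingle (aeq_unit F X : hom X (zpow F (-1) (F X))).

Lemma orbit_up_down X : orbit_down X \oc orbit_up X = idc (X : O).
Proof.
rewrite [LHS]orbit_comp_dsingle; apply: zeq_dsingle; apply: zeq_sym.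
exists erefl; rewrite /hcomp /= comp1c.
(* The exponents are closed integers, so the two ends of each cast are convertible and the cast is
   an identity. *)
rewrite (@zcast_id _ _ 0 (zpred_oppn 0 1)) (@zcast_id _ _ 1 (esym (add0r 1))).
rewrite comp1c !fmap1 !compc1.
exact/esym/(nt_invK (aeq_unit F)).
Qed.

Lemma orbit_down_up X : orbit_up X \oc orbit_down X = idc (F X : O).
Proof.
rewrite [LHS]orbit_comp_dsingle; apply: zeq_dsingle; apply: zeq_sym.
exists erefl; rewrite /hcomp /=.
rewrite (@zcast_id _ _ 0 (zsucc_add 0 (-1))) (@zcast_id _ _ (-1) (esym (add0r (-1)))).
(* Here the triangle identity of the corrected counit is essential: at F X it must be F of the
   inverse unit. *)
rewrite !comp1c !fmap1 !compc1 counit_triangle -fmap_comp -[LHS]fmap1.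
by congr (fmap F _); exact/esym/(nt_invK (aeq_unit F)).
Qed.

Lemma orbit_comp_pr (X Y Z : T) p (g : hom Y (zpow F p Z)) (f : hom X Y) :
  (dsingle g : hom (Y : O) Z) \oc pr f = dsingle (g \oc f).
Proof.
rewrite [LHS]orbit_comp_dsingle; apply: zeq_dsingle; apply: zeq_sym.
by rewrite /hcomp; apply: zeq_comp; rewrite -{1}[g]comp1c; exact/zeq_comp/mu0.
Qed.

Lemma dsingle_comp (X Y Z : T) p q (g : hom Y (zpow F p Z)) (f : hom X Y) :
  (dsingle (g \oc f) : orbit_hom F X Z) q = (dsingle g : orbit_hom F Y Z) q \oc f.
Proof.
rewrite /= /dsingle_fun; case: eqP => [e|_]; last by rewrite comp0c.
by case: q / e.
Qed.

Lemma orbit_pr0 (X Y : T) (f : hom X Y) : (pr f : orbit_hom F X Y) 0 = f.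
Proof. exact: (@dsingle_funE _ (fun p : int => hom X (zpow F p Y))). Qed.

(* The component of degree 0 of g \oc f, for g of degree q and f the identity
   of zpow p Y in degree p. *)
Definition orbit_deg0 p q (Y Z : T) (g : hom Y (zpow F q Z)) : hom (zpow F p Y) Z :=
  (dsingle (mu F p q Z \oc fmap (zpow F p) g) : orbit_hom F (zpow F p Y) Z) 0.

Lemma orbit_deg0_eq0 p q (Y Z : T) (g : hom Y (zpow F q Z)) :
  p + q <> 0 -> orbit_deg0 p g = 0.
Proof. exact: dsingle_fun0. Qed.

(** Each summand is a composite in T of a morphism depending only on p and g q with the component f
    p. Approximations in T are read off from these two factors. *)
Lemma orbit_comp0 (X Y Z : T) (g : orbit_hom F Y Z) (f : orbit_hom F X Y)
    (s t : seq int) :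
  (forall p, p \notin s -> f p = 0) -> (forall q, q \notin t -> g q = 0) ->
  orbit_comp g f 0 =
    \sum_(p <- undup s) \sum_(q <- undup t) orbit_deg0 p (g q) \oc f p.
Proof.
move=> f0 g0; rewrite (orbit_compE f0 g0) dsum_sumE; apply: eq_bigr => p _.
by rewrite dsum_sumE; apply: eq_bigr => q _; exact: dsingle_comp.
Qed.

Lemma orbit_isomorphic (X Y : T) : isomorphic X Y -> @isomorphic O X Y.
Proof. exact: (isomorphic_fmap (orbit_proj F)). Qed.

Lemma orbit_aeq_isomorphic (X : T) : @isomorphic O (F X) X.
Proof.
by exists (orbit_down X), (orbit_up X); rewrite orbit_down_up orbit_up_down.
Qed.

Lemma orbit_inv_isomorphic (X : T) : @isomorphic O (aeq_inv F X) X.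
Proof.
apply: isomorphic_trans (orbit_isomorphic (isomorphic_counit F X)).
exact/isomorphic_sym/orbit_aeq_isomorphic.
Qed.

Lemma orbit_zpow_isomorphic p (X : T) : @isomorphic O (zpow F p X) X.
Proof.
have iterP (P : functor T T) n :
    (forall Y : T, @isomorphic O (P Y) Y) -> @isomorphic O (iter_functor n P X) X.
  move=> PX; elim: n => [|n IHn]; last exact: isomorphic_trans (PX _) IHn.
  by exists (idc (X : O)); exact: iso_idc.
by case: p => n; apply: iterP; [exact: orbit_aeq_isomorphic|exact: orbit_inv_isomorphic].
Qed.

Lemma orbit_proj_inj (X Y : T) (f : hom X Y) : pr f = 0 -> f = 0.
Proof. by move=> f0; rewrite -[f]orbit_pr0 f0. Qed.

Lemma orbit_subcategory_periodic (S : set T) :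
  @is_subcategory O S -> is_subcategory S /\ periodic F S.
Proof.
move=> Ssub; split=> [X Y /orbit_isomorphic|]; first exact: Ssub.
apply/seteqP; split=> [Y [X SX /orbit_isomorphic FXY]|Y SY].
  apply: Ssub SX; apply: isomorphic_trans FXY.
  exact/isomorphic_sym/orbit_aeq_isomorphic.
exists (aeq_inv F Y); last exact: isomorphic_counit.
by apply: Ssub SY; exact/isomorphic_sym/orbit_inv_isomorphic.
Qed.

(** * Morphisms out of a periodic subcategory, and approximations *)

Section Source.
Variables (S : set T).
Hypotheses (Ssub : is_subcategory S) (Sper : periodic F S).

(** By additivity f may be taken homogeneous. Replacing X by F X or by its image under the
    quasi-inverse, both in S, moves the degree by one, until it reaches 0, where f is a
    projection. *)
Lemma orbit_hom_source_ind (W : T) (Q : forall X : O, hom X (W : O) -> Prop) :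
  (forall X, Q X 0) -> (forall X f g, Q X f -> Q X g -> Q X (f + g)) ->
  (forall X Y (f : hom Y (W : O)) (g : hom X Y), Q Y f -> Q X (f \oc g)) ->
  (forall (X : T) (v : hom X W), S X -> Q X (pr v)) ->
  forall (X : T) (f : hom (X : O) (W : O)), S X -> Q X f.
Proof.
move=> Q0 QD QM Qpr X f SX.
pose P p := forall X, S X -> forall v : hom X (zpow F p W), Q X (dsingle v).
suff {X f SX} PP p : P p.
  by elim/dsum_ind: f => [||p v]; [exact: Q0|exact: QD|exact: PP].
(* X is a retract of Y in O, so Q may be tested after restriction to Y. *)
have QK X Y (f : hom (X : O) (W : O)) (a : hom (X : O) Y) (b : hom Y (X : O)) :
    b \oc a = idc X -> Q Y (f \oc b) -> Q X f.
  by move=> ba Qfb; rewrite -[f]compc1 -ba compA; exact: QM.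
have down q : P (1 + q) -> P q.
  move=> Pq X SX v; apply: (QK _ _ _ _ _ (orbit_up_down X)).
  by rewrite [X in Q _ X]orbit_comp_dsingle; apply: Pq; exact: periodic_aeq.
(* Two retractions: the counit replaces X by F of its image under the quasi-inverse, then [orbit_up]
   removes this F and lowers the degree. *)
have up q : P (-1 + q) -> P q.
  move=> Pq X SX v; have SGX := periodic_inv Ssub Sper SX.
  have [c [c' [c'c cc']]] := isomorphic_counit F X.
  have prK : pr c \oc pr c' = idc (X : O) by rewrite -fmap_comp cc' fmap1.
  apply: (QK _ _ _ _ _ prK); rewrite orbit_comp_pr.
  apply: (QK _ _ _ _ _ (orbit_down_up _)).
  by rewrite [X in Q _ X]orbit_comp_dsingle; exact: Pq.
elim/zsucc_ind: p => [|p]; first by move=> X SX v; exact: Qpr.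
split=> Pp; first by apply: up; rewrite zsuccE addrCA addNr addr0.
by apply: down; rewrite addrC -zsuccE.
Qed.

Lemma orbit_hom0_source (W : T) :
  (forall X : T, S X -> forall e : hom X W, e = 0) ->
  forall X : T, S X -> forall e : hom (X : O) (W : O), e = 0.
Proof.
move=> h X SX e; apply: (@orbit_hom_source_ind W (fun X f => f = 0)) SX => //.
- by move=> Y f g -> ->; rewrite addr0.
- by move=> Y Z f g ->; rewrite comp0c.
- by move=> Y v /h v0; rewrite (v0 v) fmap0.
Qed.

Lemma orbit_contravariantly_finite :
  contravariantly_finite S -> @contravariantly_finite O S.
Proof.
move=> Sfin Z; have [X [SX [f fP]]] := Sfin Z.
exists X; split=> //; exists (pr f) => X' SX' g.
apply: (@orbit_hom_source_ind Z (fun Y g => exists h, g = pr f \oc h)) SX'.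
- by move=> Y; exists 0; rewrite compc0.
- by move=> Y _ _ [h ->] [h' ->]; exists (h + h'); rewrite compDr.
- by move=> Y Y' _ k [h ->]; exists (h \oc k); rewrite compA.
- by move=> Y v SY; have [h ->] := fP Y SY v; exists (pr h); rewrite fmap_comp.
Qed.

Lemma orbit_covariantly_finite : covariantly_finite S -> @covariantly_finite O S.
Proof.
move=> Sfin Z; have [X [SX [f fP]]] := Sfin Z.
exists X; split=> //; exists (pr f) => X' SX' g.
elim/dsum_ind: g => [|_ _ [h ->] [h' ->]|p v].
- by exists 0; rewrite comp0c.
- by exists (h + h'); rewrite compDl.
(* The target F^p X' of v is again in S, so v factors through f already in T. *)
- have [h ->] := fP _ (periodic_zpow p Ssub Sper SX') v.
  by exists (dsingle h); rewrite orbit_comp_pr.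
Qed.

(** The nonzero components f q : X -> F^q Z are finite in number. Translated by F^(-q) they become
    morphisms F^(-q) X -> Z with source in S, and k combines them. *)
Lemma contravariantly_finite_orbit : is_additive T -> sum_closed S ->
  @contravariantly_finite O S -> contravariantly_finite S.
Proof.
move=> Tadd Ssum Sfin Z; have [X [SX [f fP]]] := Sfin Z.
have [t f0] := dsum_supp f.
have [|X0 SX0 [k kP]] :=
    @sum_closed_factor _ int S Z _ (fun q => orbit_deg0 (-q) (f q)) t Tadd Ssum.
  by move=> q; exact: periodic_zpow.
exists X0; split=> //; exists k => X' SX' g.
have [h gfh] := fP X' SX' (pr g); have [s h0] := dsum_supp h.
rewrite -[g](orbit_pr0) gfh (orbit_comp0 h0 f0).
apply: factor_sum => p _; rewrite big_seq; apply: factor_sum => q.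
rewrite mem_undup => /kP[u uE].
(* Only p = -q contributes to degree 0; there the term passes through the translate of f q, hence
   through k. *)
have [pq|pq] := eqVneq p (- q); first by subst p; exists (u \oc h (-q)); rewrite uE compA.
exists 0; rewrite compc0 orbit_deg0_eq0 ?comp0c//.
by move=> /eqP; rewrite addr_eq0; exact/negP.
Qed.

Lemma covariantly_finite_orbit : is_additive T -> sum_closed S ->
  @covariantly_finite O S -> covariantly_finite S.
Proof.
move=> Tadd Ssum Sfin Z; have [X [SX [f fP]]] := Sfin Z.
have [s f0] := dsum_supp f.
have [|X0 SX0 [k kP]] := @sum_closed_cofactor _ int S Z _ f s Tadd Ssum.
  by move=> p; exact: periodic_zpow.
exists X0; split=> //; exists k => X' SX' g.
have [h gfh] := fP X' SX' (pr g); have [t h0] := dsum_supp h.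
rewrite -[g](orbit_pr0) gfh (orbit_comp0 f0 h0).
rewrite big_seq; apply: cofactor_sum => p.
rewrite mem_undup => /kP[u ->]; apply: cofactor_sum => q _.
by rewrite compA; eexists.
Qed.

End Source.

(** * Comparison of Ext and of cluster tilting in T and in O *)

Section Triangulated.
Variables (tT : triangulation T) (tO : triangulation O) (m : nat).
Hypothesis prt : is_triangle_functor tT tO (orbit_proj F).

Lemma orbit_iter_susp i (X : T) :
  @isomorphic O (iter_functor i (susp tT) X) (iter_functor i (susp tO) X).
Proof.
case: prt => phi _; elim: i => [|i IHi]; first by exists (idc (X : O)); exact: iso_idc.
exact: isomorphic_trans (isomorphic_nt phi _) (isomorphic_fmap (susp tO) IHi).
Qed.

Lemma orbit_Ext0 i (X Z : T) :
  (forall e : Ext tO i X Z, e = 0) <->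
  (forall e : hom (X : O) (iter_functor i (susp tT) Z : O), e = 0).
Proof.
split; apply: hom0_isomorphic; last exact: orbit_iter_susp.
exact/isomorphic_sym/orbit_iter_susp.
Qed.

Lemma orbit_Ext0_proj i (X Z : T) :
  (forall e : Ext tO i X Z, e = 0) -> forall e : Ext tT i X Z, e = 0.
Proof. by move=> /orbit_Ext0 h e; apply: orbit_proj_inj; exact: h. Qed.

Lemma orbit_right_perp (S : set T) : is_subcategory S -> periodic F S ->
  right_perp tO m S = right_perp tT m S.
Proof.
move=> Ssub Sper; apply/seteqP; split=> Z hZ i im X SX.
  exact/orbit_Ext0_proj/(hZ i im).
by apply/orbit_Ext0; exact: (orbit_hom0_source Ssub Sper (hZ i im)).
Qed.

Lemma orbit_left_perp_sub (S : set T) : left_perp tO m S `<=` left_perp tT m S.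
Proof. by move=> Z hZ i im X SX; exact/orbit_Ext0_proj/(hZ i im). Qed.

(* F need not commute with the suspension of T, but F^p Sigma^i X is some Sigma^i X',
   and Sigma^i X' is isomorphic to Sigma^i X in O, hence so is X' to X. *)
Lemma orbit_left_perp (S : set T) : @is_subcategory O S ->
  left_perp tO m S = left_perp tT m S.
Proof.
move=> Ssub; apply/seteqP; split=> [|Z hZ i im X SX]; first exact: orbit_left_perp_sub.
apply/orbit_Ext0 => e; apply: dsum_ext => p.
have [X' X'E] := iter_aeq_surj (susp tT) i (zpow F p (iter_functor i (susp tT) X)).
apply: (hom0_isomorphic X'E (hZ i im X' _)).
apply: Ssub SX; apply: isomorphic_sym.
apply: (@iter_aeq_isomorphic _ (susp tO) i).
apply: isomorphic_trans (isomorphic_sym (orbit_iter_susp i X')) _.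
apply: isomorphic_trans (orbit_isomorphic X'E) _.
exact: isomorphic_trans (orbit_zpow_isomorphic p _) (orbit_iter_susp i X).
Qed.

(** The right perpendicular is compared first, since it yields closure of S under isomorphism in O.
    For the left one, one inclusion is the vanishing of Ext within S, the other the faithfulness of
    the projection. *)
Lemma orbit_cluster_tilting (S : set T) : is_subcategory S -> periodic F S ->
  cluster_tilting tT m S -> @cluster_tilting O tO m S.
Proof.
move=> Ssub Sper [_ [Scov Scontra] Sright Sleft].
have SE : S = right_perp tO m S by rewrite orbit_right_perp.
split=> //.
- by rewrite SE; exact: right_perp_isomorphic.
- by split; [exact: orbit_covariantly_finite|exact: orbit_contravariantly_finite].
apply/seteqP; split; first exact: right_perp_left.
by rewrite [X in _ `<=` X]Sleft; exact: orbit_left_perp_sub.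
Qed.

Lemma cluster_tilting_orbit (S : set T) :
  @cluster_tilting O tO m S -> periodic F S /\ cluster_tilting tT m S.
Proof.
move=> [SsubO [Scov Scontra] Sright Sleft].
have [Ssub Sper] := orbit_subcategory_periodic SsubO.
have SE : S = right_perp tT m S by rewrite -(orbit_right_perp Ssub).
(* As a perpendicular, S contains the finite sums from which the approximations in T are built. *)
have Ssum : sum_closed S by rewrite SE; exact: right_perp_sum_closed.
have Tadd := tri_additive tT.
split=> //; split=> //.
- by split; [exact: covariantly_finite_orbit|exact: contravariantly_finite_orbit].
- by rewrite -[RHS](orbit_left_perp SsubO).
Qed.

End Triangulated.
End Orbit.

Theorem theorem7 (T : preadditive) (tT : triangulation T) (F : autoequivalence T)
    (tO : triangulation (orbit_category F)) (m : nat) :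
  locally_finite T ->
  is_triangle_functor tT tO (orbit_proj F) ->
  (1 <= m)%N ->
  exists f : set T -> set (orbit_category F),
    set_bij [set S : set T | periodic F S /\ cluster_tilting tT m S]
            [set S : set (orbit_category F) | cluster_tilting tO m S] f.
Proof.
move=> _ prt _; exists (fun S => S); split=> [S /= [Sper Sct]|//|S /= Sct].
  by apply: (orbit_cluster_tilting prt _ Sper Sct); case: Sct.
by exists S; first exact: (cluster_tilting_orbit prt Sct).
Qed.
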